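(* There exist a totally disconnected compact metrizable space $X$ and an expansive homeomorphism $T:X\to X$ with positive topological entropy such that $T$ has no off-diagonal asymptotic pair.
   Context: Let $d$ be a compatible metric on $X$. A homeomorphism $T$ is expansive if there is $c>0$ such that for all $x\neq y$ in $X$ there is $n\in\mathbb{Z}$ with $d(T^nx,T^ny)>c$. A pair $(x,y)\in X\times X$ is asymptotic if for every $\epsilon>0$ there are at most finitely many $n\in\mathbb{Z}$ with $d(T^nx,T^ny)>\epsilon$ (so asymptotic in both time directions); it is off-diagonal if $x\neq y$. *)

(* Defs.v *)
From HB Require Import structures.
From mathcomp Require Import all_boot all_order all_algebra finmap.
From mathcomp Require Import all_classical all_reals all_analysis.

Set Implicit Arguments.
Unset Strict Implicit.
Unset Printing Implicit Defensive.

Import Order.TTheory GRing.Theory Num.Theory.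
Import numFieldNormedType.Exports.

Local Open Scope classical_set_scope.
Local Open Scope ring_scope.

Definition homeomorphism (X : topologicalType)
    (T : {splitbij [set: X] >-> [set: X]}) : Prop :=
  continuous T /\ continuous (T^-1)%FUN.

Definition iterz (X : Type) (T : {splitbij [set: X] >-> [set: X]}) (n : int) :
    X -> X :=
  match n with
  | Posz k => iter k T
  | Negz k => iter k.+1 (T^-1)%FUN
  end.

Definition expansive (R : realType) (X : metricType R)
    (T : {splitbij [set: X] >-> [set: X]}) : Prop :=
  exists2 c : R, 0 < c &
    forall x y : X, x <> y -> exists n : int,
      c < mdist (iterz T n x) (iterz T n y).

Definition asymptotic (R : realType) (X : metricType R)
    (T : {splitbij [set: X] >-> [set: X]}) (x y : X) : Prop :=
  forall eps : R, 0 < eps ->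
    finite_set [set n : int | eps < mdist (iterz T n x) (iterz T n y)].

(* Topological entropy in the Bowen-Dinaburg form: A is (n, eps)-separated when
   distinct points of A are more than eps apart for the metric
   max_(0 <= k < n) d (T^k x) (T^k y). *)
Definition separated (R : realType) (X : metricType R) (T : X -> X)
    (n : nat) (eps : R) (A : {fset X}) : Prop :=
  forall x y : X, x \in A -> y \in A -> x <> y ->
    exists2 k : nat, (k < n)%N & eps < mdist (iter k T x) (iter k T y).

Definition sep_number (R : realType) (X : metricType R) (T : X -> X)
    (n : nat) (eps : R) : \bar R :=
  ereal_sup [set (#|` A|%:R)%:E | A in [set A : {fset X} | separated T n eps A]].

(* The limsup is nonincreasing in eps, so its limit as eps tends to 0 is the
   supremum over eps > 0. Since lne 0 = -oo, the empty space has entropy -oo. *)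
Definition top_entropy (R : realType) (X : metricType R) (T : X -> X) : \bar R :=
  ereal_sup
    [set limn_esup (fun n : nat => ((n%:R^-1)%:E * lne (sep_number T n eps))%E)
    | eps in [set eps : R | 0 < eps]].

(* Main.v *)
Require Import Defs.
From HB Require Import structures.
From mathcomp Require Import all_boot all_order all_algebra finmap.
From mathcomp Require Import all_classical all_reals all_analysis.
From mathcomp Require Import zify.

Set Implicit Arguments.
Unset Strict Implicit.
Unset Printing Implicit Defensive.

Import Order.TTheory GRing.Theory Num.Theory.
Local Open Scope ring_scope.

(** The example is a subshift on the alphabet [bool * bool]: a bi-infinite
sequence carries at each place a mark and a data bit.  Fix block lengths
[scale 0 = 1] and [scale (j+1) = ratio j * scale j] with [ratio j = 2^(j+2)],
and a phase, that is a nested choice of subdivisions of the integers into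
blocks of each length [scale j].  Inside a block of level [j+1] the marks of
two consecutive sub-blocks of level [j] are opposite ([marking_rule], a
Thue-Morse pattern), and for each place of the first sub-block the data bits at
the [ratio j] corresponding places of the sub-blocks have sum zero modulo 2
([parity_rule]).  The space consists of all sequences obeying both rules for
some phase; it is closed and shift invariant, hence a compact, totally
disconnected, expansive system.

Asymptotic pairs.  Two sequences with the same phase that differ at one place
differ also at a place at distance at least [scale j], for every [j]
([differ_far]): a changed mark propagates to the neighbouring sub-block, and a
single changed data bit would break a parity.  So they differ infinitely often.
Two sequences with eventually equal marks have the same phase
([phase_unique]): if their level-[j+1] blocks were placed differently, the
exceptional sub-block of one sequence would be a regular one of the other, so
the marks would alternate from sub-block to sub-block everywhere, and then have
period [scale (j+1)] because [ratio j] is even, against the marking rule of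
level [j+1].  Since expansiveness makes asymptotic points differ at finitely
many places, an asymptotic pair is diagonal.

Entropy.  The parity rules of levels below [J] impose
[sum_(j < J) scale J / ratio j <= scale J / 2] linear conditions over the field
with two elements on a data word of length [scale J], so at least
[2^(scale J / 2)] words satisfy them ([card_admissible_words]).  Each such word
extends periodically to a point ([word_good]): at the levels from [J] on, a
parity condition adds an even number of equal bits.  The entropy is therefore at
least [ln 2 / 2]. *)

(** * Blocks, phases and the two rules *)

(** Even, so that a run of [ratio j] alternating sub-blocks closes up; and growing
so fast that the inverses sum to 1/2, which keeps the parity conditions from
using up more than half of the data bits. *)
Definition ratio (j : nat) : nat := (2 ^ j.+2)%N.

Fixpoint scale (j : nat) : nat := if j is i.+1 then (ratio i * scale i)%N else 1%N.

Lemma scale_gt0 j : (0 < scale j)%N.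
Proof. by elim: j => //= j IH; rewrite muln_gt0 IH expn_gt0. Qed.

Lemma ratio_ge4 j : (4 <= ratio j)%N.
Proof. by rewrite /ratio (leq_pexp2l (m := 2) (n1 := 2)). Qed.

Lemma ratio_even j : ~~ odd (ratio j).
Proof. by rewrite /ratio oddX. Qed.

Lemma ltn_scale j : (j < scale j)%N.
Proof.
elim: j => //= j IH; have := ratio_ge4 j.
by have := scale_gt0 j; nia.
Qed.

Lemma dvdn_scale i j : (i <= j)%N -> (scale i %| scale j)%N.
Proof.
elim: j => [|j IH]; first by rewrite leqn0 => /eqP ->.
by rewrite leq_eqVlt => /predU1P[->//|/IH h]; rewrite dvdn_mull.
Qed.

Lemma scale_quot_even i j : (i < j)%N -> ~~ odd (scale j %/ scale i).
Proof.
move=> ij; have /dvdnP[q ->] := dvdn_scale ij.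
by rewrite /= mulnA mulnK ?scale_gt0// oddM negb_and ratio_even orbT.
Qed.

(** A coherent phase is a point of the odometer, the inverse limit of the cyclic
groups of order [scale j]; the blocks of level [j] start at the places [n] with
[n + p j] divisible by [scale j]. *)
Definition phase := nat -> nat.

Definition coherent (p : phase) := forall j, p j = (p j.+1 %% scale j)%N.

Definition position (p : phase) j (n : int) : int :=
  ((n + (p j)%:Z) %% (scale j)%:Z)%Z.

(** The condition says that [n] is not in the last sub-block of its block of level
[j+1]; nothing is asked of the marks across the border of such a block, and this
is what makes the border visible. *)
Definition marking_rule (p : phase) (mark : int -> bool) := forall j n,
  position p j.+1 n < (scale j.+1)%:Z - (scale j)%:Z ->
  mark (n + (scale j)%:Z) = ~~ mark n.

Definition parity_rule (p : phase) (data : int -> bool) := forall j n,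
  position p j.+1 n < (scale j)%:Z ->
  \big[addb/false]_(i < ratio j) data (n + (i * scale j)%N%:Z) = false.

Definition good (p : phase) (x : int -> bool * bool) :=
  [/\ coherent p, marking_rule p (fst \o x) & parity_rule p (snd \o x)].

Lemma position_ge0 p j n : 0 <= position p j n.
Proof. by rewrite /position modz_ge0// eqz_nat -lt0n scale_gt0. Qed.

Lemma position_lt p j n : position p j n < (scale j)%:Z.
Proof. by rewrite /position ltz_pmod// ltz_nat scale_gt0. Qed.

Lemma coherent_lt p j : coherent p -> (p j < scale j)%N.
Proof. by move->; rewrite ltn_mod scale_gt0. Qed.

Lemma modz_dvdm (c d n : int) : (d %| c)%Z -> ((n %% c)%Z = n %[mod d])%Z.
Proof.
by move=> /dvdzP[q ->]; rewrite [in RHS](divz_eq n (q * d)) mulrA modzMDl.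
Qed.

Lemma eq_small_congr (d lo a b : int) : (a = b %[mod d])%Z ->
  lo <= a < lo + d -> lo <= b < lo + d -> a = b.
Proof.
move=> /eqP; rewrite eqz_mod_dvd => /dvdzP[q hq] ha hb.
by case: (eqVneq q 0) hq => [->|q0] hq; nia.
Qed.

Lemma position_shift p j n (k : int) :
  0 <= position p j n + k < (scale j)%:Z ->
  position p j (n + k) = position p j n + k.
Proof.
by move=> h; rewrite -[RHS](modz_small h) /position modzDml addrAC.
Qed.

Lemma position_mod p j n : coherent p ->
  (position p j.+1 n = position p j n %[mod (scale j)%:Z])%Z.
Proof.
move=> cp; rewrite /position modz_mod (cp j) -modz_nat modzDmr.
rewrite modz_dvdm//.
by rewrite /= dvdzE/= dvdn_mull.
Qed.

(** A difference in marks passes to the next sub-block of level [j], or to the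
previous one at the end of a block of level [j+1].  If only the data differ, the
parity condition through [n] is an equation that both sequences satisfy, so it
involves a second place where they differ. *)
Lemma differ_far p x y n j : good p x -> good p y -> x n <> y n ->
  exists n', x n' <> y n' /\ (scale j)%:Z <= `|n' - n|.
Proof.
move=> [_ mx dx] [_ my dy] xyn.
have r0 := position_ge0 p j.+1 n; have r1 := position_lt p j.+1 n.
have N0 := scale_gt0 j; have m4 := ratio_ge4 j.
have [e1|/eqP ne1] := eqVneq (x n).1 (y n).1.
  have ne2 : (x n).2 <> (y n).2.
    by move=> e2; apply: xyn; rewrite [x n]surjective_pairing e1 e2 -surjective_pairing.
  (* The parity condition through [n] starts at [n0], where [n] has index [i]. *)
  pose r := `|position p j.+1 n|%N; pose i := (r %/ scale j)%N.
  have rE : position p j.+1 n = r%:Z by rewrite /r gez0_abs.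
  have im : (i < ratio j)%N.
    by rewrite /i ltn_divLR// -ltz_nat -rE.
  pose n0 := n - (i * scale j)%N%:Z.
  have ri : r = (i * scale j + r %% scale j)%N by rewrite {1}(divn_eq r (scale j)).
  have rs : (r %% scale j < scale j)%N by rewrite ltn_mod.
  have p0 : position p j.+1 n0 = (r %% scale j)%N%:Z.
    rewrite /n0 position_shift rE; first by rewrite {1}ri; lia.
    by rewrite {1 2}ri /=; nia.
  have hn0 : position p j.+1 n0 < (scale j)%:Z by rewrite p0 ltz_nat.
  have := dx j n0 hn0; rewrite (bigD1 (Ordinal im) isT) /= subrK => hx.
  have := dy j n0 hn0; rewrite (bigD1 (Ordinal im) isT) /= subrK => hy.
  apply: contrapT => no.
  apply: ne2.
  suff e : \big[addb/false]_(k < ratio j | k != Ordinal im)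
      (x (n0 + (k * scale j)%N%:Z)).2 =
      \big[addb/false]_(k < ratio j | k != Ordinal im)
      (y (n0 + (k * scale j)%N%:Z)).2.
    by move: hx; rewrite e => hx; move: (etrans hx (esym hy)) => /addIb.
  apply: eq_bigr => k ki; apply: contrapT => ne.
  apply: no; exists (n0 + (k * scale j)%N%:Z); split; first by move=> e; rewrite e in ne.
  have : (k : nat) <> i by move=> e; move/eqP: ki; apply; exact: val_inj.
  rewrite /n0; nia.
have [lt|ge] := ltP (position p j.+1 n) ((scale j.+1)%:Z - (scale j)%:Z).
  exists (n + (scale j)%:Z); split; last by lia.
  move=> e; apply: ne1; have /= := mx _ _ lt; have /= := my _ _ lt.
  by rewrite e => -> /(can_inj negbK).
have sE : scale j.+1 = (ratio j * scale j)%N by [].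
have pE : position p j.+1 (n - (scale j)%:Z) = position p j.+1 n - (scale j)%:Z.
  by rewrite position_shift//; nia.
exists (n - (scale j)%:Z); split; last by lia.
have lt : position p j.+1 (n - (scale j)%:Z) < (scale j.+1)%:Z - (scale j)%:Z by rewrite pE; lia.
move=> e; apply: ne1; have /= := mx _ _ lt; have /= := my _ _ lt.
by rewrite subrK e => -> ->.
Qed.

(** Induction on the level.  If the phases agree at level [j] but not at level
[j+1], then no place is in the last level-[j] sub-block for both phases, so the
marks alternate at step [scale j] without exception from [M] on.  They then have
period [scale j.+1], and this contradicts the marking rule one level higher,
applied at the start of a block of level [j+2] beyond [M]. *)
Lemma phase_unique p q x y (M : int) : good p x -> good q y ->
  (forall n, M <= n -> (x n).1 = (y n).1) -> forall j, p j = q j.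
Proof.
move=> [cp mx _] [cq my _] xy; elim=> [|j IH].
  by have := coherent_lt 0 cp; have := coherent_lt 0 cq; rewrite /=; lia.
apply: contrapT => ne.
have flip n : M <= n -> (x (n + (scale j)%:Z)).1 = ~~ (x n).1.
  move=> Mn.
  have [lt|ge] := ltP (position p j.+1 n) ((scale j.+1)%:Z - (scale j)%:Z); first exact: mx lt.
  have [lt|ge'] := ltP (position q j.+1 n) ((scale j.+1)%:Z - (scale j)%:Z).
    rewrite xy; last by lia.
    by rewrite (xy n)//; exact: my lt.
  (* Both positions lie in the last [scale j] places and are congruent modulo
     [scale j], so they coincide, and with them the phases. *)
  exfalso; apply: ne.
  have e : position p j.+1 n = position q j.+1 n.
    apply: (@eq_small_congr (scale j)%:Z ((scale j.+1)%:Z - (scale j)%:Z)).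
    - by rewrite !position_mod// /position IH.
    - by rewrite ge subrK position_lt.
    - by rewrite ge' subrK position_lt.
  apply/eqP; rewrite -eqz_nat; apply/eqP.
  apply: (@eq_small_congr (scale j.+1)%:Z 0); last 2 first.
  - by rewrite add0r le0z_nat ltz_nat coherent_lt.
  - by rewrite add0r le0z_nat ltz_nat coherent_lt.
  move/eqP: e; rewrite /position !(addrC n) eqz_modDr.
  by move/eqP.
have flips k n : M <= n -> (x (n + (k * scale j)%N%:Z)).1 = odd k (+) (x n).1.
  elim: k n => [|k IHk] n Mn; first by rewrite mul0n addr0.
  rewrite mulSn PoszD addrA IHk; last by lia.
  by rewrite flip//= addbN addNb.
pose n := (scale j.+2)%:Z * (`|M|%:Z + 1) - (p j.+2)%:Z.
have Mn : M <= n.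
  have := coherent_lt j.+2 cp; have := scale_gt0 j.+2; rewrite /n; nia.
have pn : position p j.+2 n = 0.
  by rewrite /position /n subrK modzMr.
have := mx j.+1 n; rewrite pn /= flips// (negbTE (ratio_even j)) => h.
suff : (x n).1 = ~~ (x n).1 by case: (_.1).
apply: h; have := scale_gt0 j; have := ratio_ge4 j; have := ratio_ge4 j.+1.
nia.
Qed.

Lemma good_shift p x a : good p x ->
  exists q, good q (fun n => x (n + a)).
Proof.
move=> [cp mx dx].
pose q j := `|(((p j)%:Z - - a) %% (scale j)%:Z)%Z|%N.
have qE j : (q j)%:Z = (((p j)%:Z + a) %% (scale j)%:Z)%Z.
  by rewrite /q opprK gez0_abs// modz_ge0// eqz_nat -lt0n scale_gt0.
have pos j n : position q j n = position p j (n + a).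
  by rewrite /position qE modzDmr addrA addrAC.
exists q; split.
- move=> j; apply/eqP; rewrite -eqz_nat -modz_nat !qE; apply/eqP.
  rewrite modz_dvdm; last by rewrite dvdzE/= dvdn_mull.
  by rewrite cp -modz_nat modzDml.
- by move=> j n; rewrite pos /= => /mx /=; rewrite addrAC.
- move=> j n; rewrite pos => /dx h; rewrite -[RHS]h; apply: eq_bigr => i _ /=.
  by rewrite addrAC.
Qed.

(** * A mark sequence for the zero phase *)

Arguments scale : simpl never.

Lemma scaleS j : scale j.+1 = (ratio j * scale j)%N.
Proof. by []. Qed.

(** The parity of the digit sum of [k] in the mixed radix system with place values
[scale i]: since the ratios are even, [k %/ scale i] has the parity of the
digit [i].  The terms with [i >= k] vanish because [k < scale k]. *)
Definition digit_parity (k : nat) : bool := odd (\sum_(i < k) k %/ scale i).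

Lemma digit_parityE k b : (k <= b)%N ->
  digit_parity k = odd (\sum_(i < b) k %/ scale i).
Proof.
move=> kb; rewrite /digit_parity -(subnK kb) addnC big_split_ord /=.
rewrite [X in (_ + X)%N]big1 ?addn0// => i _.
by rewrite divn_small// (leq_ltn_trans _ (ltn_scale _))// leq_addr.
Qed.

Lemma divn_add_small q d k c : (k %% d + c < d)%N ->
  ((k + c) %/ (q * d) = k %/ (q * d))%N.
Proof.
move=> h; have d0 : (0 < d)%N by apply: leq_ltn_trans h.
rewrite mulnC !divnMA {1}(divn_eq k d) -addnA divnMDl//.
by rewrite [X in (_ + X)%N]divn_small ?addn0.
Qed.

(** Adding [scale j] without a carry raises the digit [j] by one and leaves the
other digits alone. *)
Lemma digit_parity_flip j k : (k %% scale j.+1 < scale j.+1 - scale j)%N ->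
  digit_parity (k + scale j) = ~~ digit_parity k.
Proof.
move=> h; have N0 := scale_gt0 j.
set b := (k + scale j)%N.
rewrite (@digit_parityE k b) ?leq_addr// (@digit_parityE b b)//.
have jb : (j < b)%N by rewrite /b; have := ltn_scale j; lia.
have quot i : odd (b %/ scale i) = (i == j) (+) odd (k %/ scale i).
  have [ij|ji|->] := ltngtP i j.
  - have /dvdnP[q qE] := dvdn_scale (ltnW ij).
    have := scale_quot_even ij; rewrite /b qE mulnK ?scale_gt0// => qe.
    by rewrite (addnC k) divnMDl ?scale_gt0// oddD (negbTE qe).
  - have /dvdnP[q ->] := dvdn_scale ji.
    by rewrite divn_add_small//; lia.
  - by rewrite /b -{1}(mul1n (scale j)) (addnC k) divnMDl// oddD.
rewrite !(big_morph odd oddD (erefl _)).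
rewrite (eq_bigr (fun i : 'I_b => ((i : nat) == j) (+) odd (k %/ scale i)))
  => [|i _]; last exact: quot.
rewrite big_split /= -addTb; congr (_ (+) _).
rewrite (bigD1 (Ordinal jb))//= eqxx big1 ?addbF// => i /eqP ij.
by apply/eqP => e; apply: ij; exact: val_inj.
Qed.

(** [Negz k] stands for [-1 - k], whose digits are the complements
[ratio i - 1 - d_i] of the digits of [k].  Counting the parity of the digits of
[k] itself keeps the sum finite, and adding [scale j] to [-1 - k] lowers the
digit [j] of [k] by one when that digit is positive. *)
Definition standard_mark (n : int) : bool :=
  match n with Posz k | Negz k => digit_parity k end.

Lemma standard_markP : marking_rule (fun=> 0%N) standard_mark.
Proof.
move=> j n; rewrite /position addr0.
have N0 := scale_gt0 j; have N1 := scale_gt0 j.+1.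
have NN : (scale j < scale j.+1)%N by have := ratio_ge4 j; rewrite scaleS; nia.
case: n => k /=.
  by rewrite modz_nat => h; rewrite digit_parity_flip//=; lia.
move=> h.
have kr : (scale j <= k %% scale j.+1)%N.
  rewrite leqNgt; apply/negP => kr.
  (* The residue of [-1 - k] is the complement of that of [k]. *)
  have e : (Negz k = (scale j.+1)%:Z - 1 - (k %% scale j.+1)%N%:Z %[mod (scale j.+1)%:Z])%Z.
    rewrite NegzE {1}(divn_eq k (scale j.+1)).
    apply/eqP; rewrite eqz_mod_dvd; apply/dvdzP.
    by exists (- (k %/ scale j.+1)%N%:Z - 1); lia.
  by move: h; rewrite e modz_small; lia.
have kN : (scale j <= k)%N by apply: leq_trans kr (leq_mod _ _).
have -> : Negz k + (scale j)%:Z = Negz (k - scale j)%N by lia.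
rewrite /= -[in RHS](subnK kN) digit_parity_flip ?negbK//.
have -> : (k - scale j = k %/ scale j.+1 * scale j.+1 + (k %% scale j.+1 - scale j))%N.
  by rewrite addnBA// -divn_eq.
have kN1 := ltn_pmod k N1.
by rewrite modnMDl modn_small; lia.
Qed.

(** * Counting data words *)

(** Every nonempty fibre of an additive map is a translate of the kernel, and there
are at most [2 ^ #|K|] fibres. *)
Lemma card_additive_kernel (I K : finType) (f : {ffun I -> bool} -> {ffun K -> bool}) :
  (forall (u v : {ffun I -> bool}) k, f [ffun i => u i (+) v i] k = f u k (+) f v k) ->
  (2 ^ #|I| <= #|[set w | [forall k, ~~ f w k]]| * 2 ^ #|K|)%N.
Proof.
move=> fD; set ker := [set w | _].
have -> : (2 ^ #|I| = \sum_(v : {ffun K -> bool}) #|[pred w | f w == v]|)%N.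
  have -> : (2 ^ #|I| = #|{: {ffun I -> bool}}|)%N by rewrite card_ffun card_bool.
  rewrite -sum1_card (partition_big f xpredT)//=.
  by apply: eq_bigr => v _; rewrite sum1_card; apply: eq_card.
have -> : (#|ker| * 2 ^ #|K| = \sum_(v : {ffun K -> bool}) #|ker|)%N.
  by rewrite sum_nat_const card_ffun card_bool mulnC.
apply: leq_sum => v _.
have [w0 w0v|no] := pickP (fun w => f w == v); last first.
  by rewrite (eq_card0 no).
pose g (w : {ffun I -> bool}) := [ffun i => w i (+) w0 i].
have gK : involutive g by move=> w; apply/ffunP => i; rewrite !ffunE addbK.
rewrite -(card_imset [pred w | f w == v] (inv_inj gK)); apply: subset_leq_card.
apply/fintype.subsetP => _ /finset.imsetP[w wv ->].
rewrite inE; apply/forallP => k; rewrite fD.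
by rewrite (eqP wv) (eqP w0v) addbb.
Qed.

Definition periodize N (w : {ffun 'I_N -> bool}) (n : int) : bool :=
  oapp w false (insub `|(n %% N%:Z)%Z|%N).

Lemma periodize_congr N (w : {ffun 'I_N -> bool}) n n' :
  (n = n' %[mod N%:Z])%Z -> periodize w n = periodize w n'.
Proof. by rewrite /periodize => ->. Qed.

Lemma periodize_ord N (w : {ffun 'I_N -> bool}) (i : 'I_N) :
  periodize w (i : nat)%:Z = w i.
Proof. by rewrite /periodize modz_nat modn_small ?ltn_ord// valK. Qed.

Lemma periodizeD N (u v : {ffun 'I_N -> bool}) n :
  periodize [ffun i => u i (+) v i] n = periodize u n (+) periodize v n.
Proof. by rewrite /periodize; case: insub => //= i; rewrite ffunE. Qed.

(** The second component numbers the places below [scale J] at which a parity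
condition of level [j] starts: its quotient by [scale j] selects a block of level
[j+1], its remainder a place in the first sub-block. *)
Definition check_index J : finType := {j : 'I_J & 'I_(scale J %/ ratio j)}.

Definition check_start J (k : check_index J) : nat :=
  (tagged k %/ scale (tag k) * scale (tag k).+1 + tagged k %% scale (tag k))%N.

Definition checks J (w : {ffun 'I_(scale J) -> bool}) : {ffun check_index J -> bool} :=
  [ffun k : check_index J => \big[addb/false]_(i < ratio (tag k))
     periodize w (check_start k + i * scale (tag k))%N%:Z].

Definition admissible_words J := [set w | [forall k, ~~ @checks J w k]].

Lemma check_startP J (j : 'I_J) (t : nat) : (t < scale J)%N ->
  (t %% scale j.+1 < scale j)%N -> exists k : check_index J, tag k = j /\ check_start k = t.
Proof.
move=> tJ tj; pose q := (t %/ scale j.+1 * scale j + t %% scale j.+1)%N.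
have qlt : (q < scale J %/ ratio j)%N.
  have /dvdnP[c cE] := dvdn_scale (ltn_ord j).
  rewrite leq_divRL ?expn_gt0//.
  have tc : (t %/ scale j.+1 < c)%N by rewrite ltn_divLR ?scale_gt0// -cE.
  rewrite /q cE scaleS; move: tj tc; rewrite scaleS.
  by set a := (t %/ _)%N; set b := (t %% _)%N => tj tc; nia.
exists (existT (fun j : 'I_J => 'I_(scale J %/ ratio j)) j (Ordinal qlt)); split=> //.
rewrite /check_start /= /q divnMDl ?scale_gt0// modnMDl (divn_small tj) addn0.
by rewrite (modn_small tj) -divn_eq.
Qed.

(** Below level [J] the conditions are those checked on the word, moved by a multiple
of the period.  From level [J] on, [scale j] is a multiple of the period, so that
[ratio j] equal bits are added, an even number. *)
Lemma word_good J (w : {ffun 'I_(scale J) -> bool}) : w \in admissible_words J ->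
  good (fun=> 0%N) (fun n => (standard_mark n, periodize w n)).
Proof.
rewrite inE => /forallP wk; split; first by move=> j; rewrite mod0n.
  exact: standard_markP.
move=> j n; rewrite /position addr0 /= => h.
have [Jj|jJ] := leqP J j.
  rewrite (eq_bigr (fun=> periodize w n)) => [|i _]; last first.
    apply: periodize_congr; have /dvdnP[c ->] := dvdn_scale Jj.
    by rewrite mulnA addrC PoszM modzMDl.
  rewrite big_const_ord.
  have -> : iter (ratio j) (addb (periodize w n)) false = odd (ratio j) && periodize w n.
    by elim: (ratio j) => //= k ->; case: (odd k); case: (periodize w n).
  by rewrite (negbTE (ratio_even j)).
have NJ : (scale J)%:Z != 0 by rewrite eqz_nat -lt0n scale_gt0.
pose t := `|(n %% (scale J)%:Z)%Z|%N.
have tE : t%:Z = (n %% (scale J)%:Z)%Z by rewrite /t gez0_abs ?modz_ge0.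
have tJ : (t < scale J)%N by rewrite -ltz_nat tE ltz_pmod// ltz_nat scale_gt0.
have tj : (t %% scale (Ordinal jJ).+1 < scale (Ordinal jJ))%N.
  rewrite -ltz_nat -modz_nat tE modz_dvdm//.
  by rewrite dvdzE/= dvdn_scale.
have [k [kj kt]] := check_startP tJ tj.
have := wk k; rewrite ffunE kt kj /= => /negbTE kk; rewrite -[RHS]kk.
apply: eq_bigr => i _; apply: periodize_congr.
by rewrite PoszD tE modzDml.
Qed.

(** The sum over [j < J] of [1 / 2^(j+2)] is [1/2 - 1/2^(J+1)]; the missing term is
carried along in the induction. *)
Lemma card_check_index J : (2 * #|{: check_index J}| <= scale J)%N.
Proof.
rewrite card_tagged sumnE big_map big_enum /=.
under eq_bigr do rewrite card_ord.
move: (scale J) => X.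
suff : (\sum_(j < J) X %/ ratio j + X %/ 2 ^ J.+1 <= X %/ 2)%N.
  move=> h; rewrite mulnC; apply: leq_trans (leq_trunc_div X 2).
  by rewrite leq_mul2r /=; apply: leq_trans h; exact: leq_addr.
elim: J => [|J IH]; first by rewrite big_ord0.
rewrite big_ord_recr /=; apply: leq_trans IH.
rewrite -addnA leq_add2l /ratio.
by rewrite addnn -muln2 (expnSr 2 J.+1) divnMA leq_trunc_div.
Qed.

(** Squaring avoids the division by two in the exponent [scale J / 2]. *)
Lemma card_admissible_words J : (2 ^ scale J <= #|admissible_words J| ^ 2)%N.
Proof.
have addD : forall (u v : {ffun 'I_(scale J) -> bool}) k,
    checks [ffun i => u i (+) v i] k = checks u k (+) checks v k.
  move=> u v k; rewrite !ffunE -big_split /=.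
  by apply: eq_bigr => i _; exact: periodizeD.
have := card_additive_kernel addD; rewrite card_ord -/(admissible_words J).
set c := #|admissible_words J|; set K := #|{: check_index J}| => h.
have hK : (2 * K <= scale J)%N by exact: card_check_index.
rewrite -(leq_pmul2r (m := 2 ^ scale J)) ?expn_gt0//.
apply: leq_trans (leq_mul h h) _.
by rewrite mulnACA leq_mul// -expnD addnn -mul2n leq_exp2l.
Qed.

(** * Spaces of bi-infinite sequences *)

Local Open Scope classical_set_scope.
Local Open Scope ring_scope.

(** The field [R] is a parameter of the type so that a metric with values in [R]
can be attached to it. *)
Definition seqspace (R : realType) (A : choiceType) (P : (int -> A) -> Prop) :=
  {x : int -> A | `[<P x>]}.

HB.instance Definition _ R A P := Choice.on (@seqspace R A P).

Section SequenceMetric.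
Context (R : realType) (A : choiceType) (P : (int -> A) -> Prop).
Local Notation X := (@seqspace R A P).
Implicit Types x y z : X.

Definition weight (n : int) : R := (`|n|%N.+1%:R)^-1.

Definition differ x y : set int := [set n | sval x n <> sval y n].

(** An ultrametric: the distance is decided by the place nearest to 0 where the
sequences differ.  It is 0 for equal sequences, since the supremum of the empty
set is 0. *)
Definition dist x y : R := sup [set weight n | n in differ x y].

Lemma weight_gt0 n : 0 < weight n.
Proof. by rewrite invr_gt0 ltr0n. Qed.

Lemma weight_le1 n : weight n <= 1.
Proof. by rewrite invf_le1 ?ltr0n// ler1n. Qed.

Lemma weight_le_dist x y n : differ x y n -> weight n <= dist x y.
Proof.
move=> xyn; apply: ub_le_sup; last by exists n.
by exists 1 => _ [m _ <-]; exact: weight_le1.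
Qed.

Lemma dist_le x y e : 0 <= e -> (forall n, differ x y n -> weight n <= e) ->
  dist x y <= e.
Proof.
move=> e0 h; rewrite /dist.
have [->|ne] := eqVneq (differ x y) set0; first by rewrite image_set0 sup0.
apply: ge_sup; last by move=> _ [n xyn <-]; exact: h.
by have /set0P[n xyn] := ne; exists (weight n), n.
Qed.

Lemma dist_ge0 x y : 0 <= dist x y.
Proof.
have [e|/set0P[n xyn]] := eqVneq (differ x y) set0.
  by rewrite /dist e image_set0 sup0.
exact: le_trans (ltW (weight_gt0 n)) (weight_le_dist xyn).
Qed.

Lemma seqspace_ext x y : (forall n, sval x n = sval y n) -> x = y.
Proof. by move=> h; apply: val_inj; exact: funext. Qed.

Lemma neq_differ x y : x <> y -> differ x y !=set0.
Proof.
move=> xy; apply/set0P/eqP => e; apply: xy; apply: seqspace_ext => n.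
by apply: contrapT => xyn; have : differ x y n by []; rewrite e.
Qed.

Let dxx x : dist x x = 0.
Proof.
by apply/eqP; rewrite eq_le dist_ge0 andbT; apply: dist_le => // n; rewrite /differ/=.
Qed.

Let dpos x y : dist x y = 0 -> x = y.
Proof.
move=> d0; apply: contrapT => /neq_differ[n /weight_le_dist].
by rewrite d0 leNgt weight_gt0.
Qed.

Let dsym x y : dist x y = dist y x.
Proof.
rewrite /dist; congr (sup (_ @` _)); apply/seteqP.
by split=> n h e; apply: h.
Qed.

Let dtri y x z : dist x z <= dist x y + dist y z.
Proof.
apply: dist_le => [|n xzn]; first by rewrite addr_ge0 ?dist_ge0.
have [xyn|xyn] := pselect (differ x y n).
  by rewrite (le_trans (weight_le_dist xyn))// lerDl dist_ge0.
have yzn : differ y z n by move=> e; apply: xyn => xy; apply: xzn; rewrite xy.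
by rewrite (le_trans (weight_le_dist yzn))// lerDr dist_ge0.
Qed.

HB.instance Definition _ := isMetric.Build R X dxx dpos dsym dtri.

Lemma mdistE x y : mdist x y = dist x y.
Proof. by []. Qed.

Definition cylinder x (k : nat) : set X :=
  [set y | forall n : int, (`|n| <= k)%N -> sval y n = sval x n].

Lemma nbhs_cylinder x k : nbhs x (cylinder x k).
Proof.
have k0 : 0 < k.+1%:R^-1 :> R by rewrite invr_gt0 ltr0n.
apply: filterS (nbhsx_ballx x _ k0) => y; rewrite ballEmdist /= mdistE => d n nk.
apply: contrapT => ne; have xyn : differ x y n by move=> e; apply: ne.
have := le_lt_trans (weight_le_dist xyn) d.
by rewrite /weight ltf_pV2 ?posrE ?ltr0n// ltr_nat ltnS ltnNge nk.
Qed.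

Lemma cylinder_nbhs x (U : set X) : nbhs x U -> exists k, cylinder x k `<=` U.
Proof.
move=> /nbhs_ballP[e /= e0 eU].
have [k ke] : exists k : nat, k.+1%:R^-1 < e.
  have [k _ h] := near_infty_natSinv_lt (PosNum e0).
  by exists k; apply: h => /=.
exists k => y xy; apply: eU; rewrite ballEmdist /= mdistE.
apply: le_lt_trans ke; apply: dist_le => [|n xyn]; first by rewrite invr_ge0 ler0n.
rewrite /weight lef_pV2 ?posrE ?ltr0n// ler_nat ltnS.
by rewrite leqNgt; apply/negP => nk; apply: xyn; rewrite xy// ltnW.
Qed.

Lemma cylinder_clopen x k : clopen (cylinder x k).
Proof.
split.
  rewrite openE => y xy; rewrite /interior.
  apply: filterS (nbhs_cylinder y k) => z yz n nk.
  by rewrite yz// xy.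
rewrite -openC openE => y xy; apply: filterS (nbhs_cylinder y k) => z yz xz.
by apply: xy => n nk; rewrite -yz// xz.
Qed.

Lemma seqspace_totally_disconnected : totally_disconnected [set: X].
Proof.
apply: zero_dimension_totally_disconnected => x y /eqP/neq_differ[n xyn].
exists (cylinder x `|n|%N); split=> //; first exact: cylinder_clopen.
by move=> /(_ n (leqnn _)) e; apply: xyn.
Qed.

End SequenceMetric.

(** * The subshift *)

Lemma ultrafilter_finite_partition (T : Type) (F : set_system T) (C : finType)
  (g : T -> C) : UltraFilter F -> exists c, F [set t | g t = c].
Proof.
move=> FU; apply: contrapT => no.
have : \forall t \near F, forall c, g t <> c.
  apply: filter_forall => c.
  by have [h|//] := in_ultra_setVsetC [set t | g t = c] FU; case: no; exists c.
by move=> /filter_ex[t /(_ (g t))].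
Qed.

Definition allowed (x : int -> bool * bool) : Prop := exists p, good p x.

Section MorseParityShift.
Context (R : realType).
Local Notation X := (@seqspace R _ allowed).
Implicit Types x y : X.

Lemma allowedP x : exists p, good p (sval x).
Proof. by apply/asboolP; exact: (valP x). Qed.

(** Along an ultrafilter each symbol and each level of a chosen phase takes a
constant value on a large set, since it has finitely many possible values.  These
values form a sequence with a phase; each instance of a rule involves finitely
many of them, so that it is inherited from some point of the space. *)
Lemma compact_morse_parity_space : compact [set: X].
Proof.
rewrite compact_ultra => F FU _.
pose ph x : phase := sval (cid (allowedP x)).
have phP x : good (ph x) (sval x) by rewrite /ph; case: cid.
have /choice[v vF] n : exists a, F [set x | sval x n = a].
  exact: ultrafilter_finite_partition.
have /choice[q qF] j : exists c, F [set x | ph x j = c].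
  have [c cF] := ultrafilter_finite_partition
    (fun x => inord (ph x j) : 'I_(scale j).+1) FU.
  exists (c : nat); apply: filterS cF => x /= <-; rewrite inordK//.
  by have [cp _ _] := phP x; rewrite ltnW// ltnS coherent_lt.
have vP : allowed v.
  exists q; split.
  - move=> j; have [x [/= <- <-]] := filter_ex (filterI (qF j) (qF j.+1)).
    by have [cp _ _] := phP x; exact: cp.
  - move=> j n.
    have [x [/= e [e1 e2]]] := filter_ex
      (filterI (qF j.+1) (filterI (vF n) (vF (n + (scale j)%:Z)))).
    by rewrite /position -e -e1 -e2; have [_ mx _] := phP x; exact: mx.
  - move=> j n.
    have vFs : \forall x \near F, forall i : 'I_(ratio j),
        sval x (n + (i * scale j)%N%:Z) = v (n + (i * scale j)%N%:Z).
      by apply: filter_forall => i; exact: vF.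
    have [x [/= e ei]] := filter_ex (filterI (qF j.+1) vFs).
    rewrite /position -e => h; have [_ _ dx] := phP x.
    have := dx j n h => h'; rewrite -[RHS]h'.
    by apply: eq_bigr => i _; rewrite /= ei.
have vP' : `[<allowed v>] by apply/asboolP.
exists (exist _ v vP' : X); split=> // U /cylinder_nbhs[k kU].
apply: filterS kU _; rewrite /=.
have : \forall x \near F, forall i : 'I_k.+1,
    sval x (Posz i) = v (Posz i) /\ sval x (- Posz i) = v (- Posz i).
  by apply: filter_forall => i; apply: filterI; exact: vF.
apply: filterS => x h n nk /=.
have [nn|nn] := leP 0 n.
  by have [] := h (inord `|n|); rewrite inordK ?ltnS// gez0_abs.
by have [_] := h (inord `|n|); rewrite inordK ?ltnS// ltz0_abs// opprK.
Qed.

Lemma shift_allowed x a : `[<allowed (fun n => sval x (n + a))>].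
Proof.
by apply/asboolP; have [p px] := allowedP x; have [q qx] := good_shift a px; exists q.
Qed.

Definition shift (a : int) x : X := exist _ (fun n => sval x (n + a)) (shift_allowed x a).

Lemma shiftK a : cancel (shift a) (shift (- a)).
Proof. by move=> x; apply: seqspace_ext => n /=; rewrite subrK. Qed.

Lemma shiftNK a : cancel (shift (- a)) (shift a).
Proof. by move=> x; apply: seqspace_ext => n /=; rewrite addrK. Qed.

HB.instance Definition _ a := @Can2.Build X X setT setT (shift a) (shift (- a))
  (fun _ _ => I) (fun _ _ => I) (in1W (shiftK a)) (in1W (shiftNK a)).

Lemma shift_continuous a : continuous (shift a).
Proof.
move=> x U /cylinder_nbhs[k kU].
apply: filterS (nbhs_cylinder x (k + `|a|)) => y xy; apply: kU => n nk /=.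
by apply: xy; lia.
Qed.

Definition shift_bij : {splitbij [set: X] >-> [set: X]} := [splitbij of shift 1].

Lemma iterz_shift n x m : sval (iterz shift_bij n x) m = sval x (m + n).
Proof.
case: n => k /=.
  elim: k m => [|k IH] m /=; first by rewrite addr0.
  by rewrite IH; congr (sval x); lia.
have -> : sval (iter k (shift_bij^-1)%FUN x) (m - 1) = sval x (m - 1 - k%:Z).
  elim: k (m - 1) => [|k IH] l /=; first by rewrite subr0.
  by rewrite IH; congr (sval x); lia.
by congr (sval x); lia.
Qed.

Lemma shift_homeomorphism : homeomorphism shift_bij.
Proof. by split; exact: shift_continuous. Qed.

(** The shift by [n] moves the place [n] to the place 0, of weight 1. *)
Lemma differ_iterz x y n : differ x y n ->
  2^-1 < mdist (iterz shift_bij n x) (iterz shift_bij n y).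
Proof.
move=> xyn; apply: (@lt_le_trans _ _ (weight R 0)).
  by rewrite /weight invr1 invf_lt1 ?ltr1n ?ltr0n.
by apply: weight_le_dist; rewrite /differ /= !iterz_shift add0r.
Qed.

Lemma shift_expansive : expansive shift_bij.
Proof.
exists 2^-1; first by rewrite invr_gt0 ltr0n.
by move=> x y /neq_differ[n /differ_iterz]; exists n.
Qed.

Lemma finite_set_int_bounded (D : set int) : finite_set D ->
  exists B : nat, forall n, D n -> (`|n| <= B)%N.
Proof.
move=> /finite_seqP[s ->]; exists (\max_(n <- s) `|n|%N) => n /= ns.
by rewrite (big_rem n)//= leq_maxl.
Qed.

(** The differences of an asymptotic pair are bounded, so the marks agree far to
the right and the phases coincide; then a single difference would give another
one beyond the bound. *)
Lemma asymptotic_eq x y : asymptotic shift_bij x y -> x = y.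
Proof.
move=> xy; apply: contrapT => /neq_differ[n xyn].
have fin : finite_set (differ x y).
  apply: sub_finite_set (xy 2^-1 _); last by rewrite invr_gt0 ltr0n.
  exact: differ_iterz.
have [B DB] := finite_set_int_bounded fin.
have [p px] := allowedP x; have [q qy] := allowedP y.
have pq : p = q.
  apply: funext; apply: (phase_unique (M := B.+1) px qy) => m Bm.
  congr (_.1); apply: contrapT => /DB; lia.
have [n' [/DB n'B far]] := differ_far (B + `|n|)%N px (eq_ind_r (fun p => good p _) qy pq) xyn.
by have := ltn_scale (B + `|n|); lia.
Qed.

End MorseParityShift.

(** * Entropy *)

Section Entropy.
Context (R : realType).
Local Notation X := (@seqspace R _ allowed).

Lemma word_allowed J (w : {ffun 'I_(scale J) -> bool}) : w \in admissible_words J ->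
  `[<allowed (fun n => (standard_mark n, periodize w n))>].
Proof. by move=> /word_good h; apply/asboolP; exists (fun=> 0%N). Qed.

Definition word_point J (w : {w | w \in admissible_words J}) : X :=
  exist _ (fun n => (standard_mark n, periodize (val w) n)) (word_allowed (valP w)).

Lemma word_point_inj J : injective (@word_point J).
Proof.
move=> u w /(congr1 sval) e; apply: val_inj; apply/ffunP => i.
rewrite -!periodize_ord.
by have := congr1 (fun z : int -> bool * bool => (z (i : nat)%:Z).2) e.
Qed.

(** Two words differ at some place [i < scale J]; the shift by [i] brings the
difference to the place 0, where it costs distance 1. *)
Lemma word_points_separated J :
  Defs.separated (shift_bij R) (scale J) 2^-1
    [fset word_point u | u in {: {w | w \in admissible_words J}}]%fset.
Proof.
move=> x y /imfsetP[u _ ->] /imfsetP[w _ ->] uw.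
have [i ui] : exists i, val u i <> val w i.
  apply: contrapT => no; apply: uw; congr word_point; apply: val_inj; apply/ffunP => i.
  by apply: contrapT => h; apply: no; exists i.
exists i; first exact: ltn_ord.
apply: (@differ_iterz _ _ _ (Posz i)) => /= -[].
by rewrite !periodize_ord.
Qed.

Lemma sep_number_scale J :
  (#|admissible_words J|%:R%:E <= sep_number (shift_bij R) (scale J) 2^-1)%E.
Proof.
apply: ereal_sup_ubound.
exists [fset word_point u | u in {: {w | w \in admissible_words J}}]%fset.
  exact: word_points_separated.
rewrite card_imfset; last exact: word_point_inj.
by rewrite /= -cardT card_sig.
Qed.

Lemma limn_esup_ge (u : (\bar R)^nat) (l : \bar R) :
  (forall m, exists2 n, (m <= n)%N & (l <= u n)%E) -> (l <= limn_esup u)%E.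
Proof.
move=> h; rewrite limn_esup_lim; apply: lime_ge; first exact: is_cvg_esups.
near=> m; have [n mn ln] := h m.
by apply: le_trans ln _; apply: ereal_sup_ubound; exists n.
Unshelve. all: by end_near. Qed.

(** At resolution 1/2 and along the times [scale m], the growth rate of the
separated sets formed by the admissible words is at least [ln 2 / 2]. *)
Lemma shift_entropy_gt0 : (0 < top_entropy (shift_bij R))%E.
Proof.
have ln2_gt0 : 0 < ln 2 / 2 :> R by rewrite divr_gt0// ln_gt0// ltr1n.
apply: (@lt_le_trans _ _ (ln 2 / 2)%:E); first by rewrite lte_fin.
apply: le_trans (ereal_sup_ubound _); last by exists 2^-1; first by rewrite /= invr_gt0 ltr0n.
apply: limn_esup_ge => m; exists (scale m); first exact/ltnW/ltn_scale.
set N := scale m; have N0 : 0 < N%:R :> R by rewrite ltr0n scale_gt0.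
have := card_admissible_words m; rewrite -/N; have := sep_number_scale m; rewrite -/N.
set c := #|_| => sepc cN.
have c0 : 0 < c%:R :> R.
  by rewrite ltr0n lt0n; apply/eqP => c0; move: cN; rewrite c0 leqn0 expn_eq0.
apply: (@le_trans _ _ (N%:R^-1%:E * lne c%:R%:E)%E).
  rewrite lne_EFin// -EFinM lee_fin [leRHS]mulrC ler_pdivlMr//.
  have : ln ((2 ^ N)%:R : R) <= ln ((c ^ 2)%:R : R).
    by rewrite ler_ln ?posrE ?ler_nat// ltr0n expn_gt0// -(ltr0n R) c0.
  rewrite !natrX !lnXn// -[ln 2 *+ N]mulr_natr -[ln c%:R *+ 2]mulr_natr.
  by rewrite mulrAC ler_pdivrMr.
apply: lee_wpmul2l; first by rewrite lee_fin invr_ge0 ltW.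
have itv (z : \bar R) : (0 <= z)%E -> z \in `[0%E, +oo%E].
  by move=> z0; rewrite in_itv/= z0 leey.
have c_ge0 : (0 <= c%:R%:E :> \bar R)%E by rewrite lee_fin ltW.
by rewrite lee_lne ?itv// (le_trans c_ge0 sepc).
Qed.

End Entropy.

Theorem theorem1p3 (R : realType) :
  exists (X : metricType R) (T : {splitbij [set: X] >-> [set: X]}),
    [/\ compact [set: X], totally_disconnected [set: X] & homeomorphism T] /\
    [/\ expansive T, (0 < top_entropy T)%E &
        ~ exists x y : X, x <> y /\ asymptotic T x y].
Proof.
exists (@seqspace R _ allowed), (shift_bij R); split; split.
- exact: compact_morse_parity_space.
- exact: seqspace_totally_disconnected.
- exact: shift_homeomorphism.
- exact: shift_expansive.
- exact: shift_entropy_gt0.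
- by move=> [x [y [xy /asymptotic_eq]]].
Qed.
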